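(* Let $P$ be a dcpo. Then $\widetilde{\mathcal{L}P}$ is order-isomorphic to $\Gamma(P)$ (nonempty Scott-closed subsets of $P$ ordered by inclusion), via the map sending $K\in\Gamma(P)$ to $\mathcal{F}_K=\{{\downarrow}F: F \text{ nonempty finite}\subseteq K\}\in\widetilde{\mathcal{L}P}$.
   Context: $LP=\{{\downarrow}F: F \text{ nonempty finite}\subseteq P\}$, ordered by inclusion. For an inclusion-directed $\mathcal{F}\subseteq LP$ and ${\downarrow}F\in LP$, write $\mathcal{F}\Rightarrow_L{\downarrow}F$ iff for each $x\in F$ there is a directed subset $D$ of $P$ with $D\subseteq\bigcup\mathcal{F}$ converging to $x$ in the Scott space $\Sigma P$. $\mathcal{L}P=(LP,O_{\Rightarrow_L}(LP))$, where $\mathcal{U}\subseteq LP$ is open iff $\mathcal{F}\Rightarrow_L{\downarrow}F\in\mathcal{U}$ implies $\mathcal{F}\cap\mathcal{U}\neq\emptyset$. For a space $X$, $\widetilde{X}$ is the smallest subset of the dcpo $\Gamma(X)$ of nonempty closed subsets (ordered by inclusion) containing all principal lower sets ${\downarrow}x$ (specialization order) and closed under suprema of directed subsets existing in $\Gamma(X)$. *)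

(* Defs.v *)
From HB Require Import structures.
From mathcomp Require Import all_boot all_order.
From mathcomp Require Import boolp classical_sets functions cardinality filter topology.

Set Implicit Arguments.
Unset Strict Implicit.
Unset Printing Implicit Defensive.

Import Order.TTheory.
Local Open Scope classical_set_scope.
Local Open Scope order_scope.

(* Induced order on subtypes; combined with the inclusion order on [set T] it
   orders any family of subsets by inclusion. *)
HB.instance Definition _ (d : Order.disp_t) (T : porderType d)
    (p : pred T) :=
  [SubChoice_isSubPOrder of {x | p x} by <: with d].

Definition directed (d : Order.disp_t) (T : porderType d) (D : set T) : Prop :=
  D !=set0 /\
  forall x y, D x -> D y -> exists z, [/\ D z, x <= z & y <= z].

Definition dcpo (d : Order.disp_t) (P : porderType d) : Prop :=
  forall D : set P, directed D -> exists x, isLub D x.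

Definition order_iso (d d' : Order.disp_t) (T : porderType d)
    (T' : porderType d') (f : T -> T') : Prop :=
  bijective f /\ {mono f : x y / x <= y}.

Definition scott_open (d : Order.disp_t) (P : porderType d) (U : set P) : Prop :=
  (forall x y, U x -> x <= y -> U y) /\
  (forall (D : set P) x, directed D -> isLub D x -> U x -> D `&` U !=set0).

(* Alias of [P] carrying the Scott topology. *)
Definition scott (d : Order.disp_t) (P : porderType d) : Type := P.

Section ScottTopology.
Context (d : Order.disp_t) (P : porderType d).

HB.instance Definition _ := Order.POrder.on (scott P).

Let open_setT : scott_open [set: scott P].
Proof. by split=> // D x [[y Dy] _] _ _; exists y. Qed.

Let open_setI : setI_closed (@scott_open d (scott P)).
Proof.
move=> U V [Uup Ulub] [Vup Vlub]; split=> [x y [Ux Vx] xy|D x dD lD [Ux Vx]].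
  by split; [exact: Uup xy|exact: Vup xy].
have [y [Dy Uy]] := Ulub _ _ dD lD Ux.
have [z [Dz Vz]] := Vlub _ _ dD lD Vx.
have [t [Dt yt zt]] := dD.2 _ _ Dy Dz.
by exists t; split=> //; split; [exact: Uup yt|exact: Vup zt].
Qed.

Let open_bigcup (I : Type) (f : I -> set (scott P)) :
  (forall i, scott_open (f i)) -> scott_open (\bigcup_i f i).
Proof.
move=> fo; split=> [x y [i _ fx] xy|D x dD lD [i _ fx]].
  by exists i => //; exact: (fo i).1 fx xy.
by have [y [Dy fy]] := (fo i).2 _ _ dD lD fx; exists y; split=> //; exists i.
Qed.

HB.instance Definition _ := isOpenTopological.Build (scott P)
  open_setT open_setI open_bigcup.

End ScottTopology.

(* [tails D] is the filter of tails of [D] seen as a net indexed by itself;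
   convergence of [D] is convergence of this filter. *)
Definition tails (d : Order.disp_t) (P : porderType d) (D : set P) :
    set_system P :=
  filter_from D (fun a => [set b | D b /\ a <= b]).

Definition scott_cvg (d : Order.disp_t) (P : porderType d) (D : set P) (x : P) :
    Prop :=
  (tails D : set_system (scott P)) --> (x : scott P).

Definition finlow (d : Order.disp_t) (P : porderType d) : set (set P) :=
  [set E | exists F : set P, [/\ finite_set F, F !=set0 & E = down F]].
Arguments finlow {d} P.

Definition LP (d : Order.disp_t) (P : porderType d) : Type :=
  set_type (finlow P).

HB.instance Definition _ (d : Order.disp_t) (P : porderType d) :=
  SubChoice.on (LP P).
HB.instance Definition _ (d : Order.disp_t) (P : porderType d) :=
  Order.POrder.copy (LP P) {E | E \in finlow P}.

(* The condition does not depend on the finite set [F] generating [E]: a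
   directed set converging to [x] also converges to every [y <= x]. *)
Definition Lcvg (d : Order.disp_t) (P : porderType d) (FF : set (LP P))
    (E : LP P) : Prop :=
  exists F : set P, [/\ finite_set F, F !=set0, val E = down F &
    forall x, F x -> exists D : set P,
      [/\ directed D, D `<=` \bigcup_(A in FF) val A & scott_cvg D x]].

Definition Lopen (d : Order.disp_t) (P : porderType d) (U : set (LP P)) : Prop :=
  forall (FF : set (LP P)) (E : LP P),
    directed FF -> Lcvg FF E -> U E -> FF `&` U !=set0.

Section LTopology.
Context (d : Order.disp_t) (P : porderType d).

Let Lopen_up (U : set (LP P)) (A B : LP P) : Lopen U -> U A -> A <= B -> U B.
Proof.
move=> Uo UA /asboolP AB.
have [F [finF F0 AF]] := set_mem (valP A).
have dB : directed [set B] by split; [exists B|move=> _ _ -> ->; exists B].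
suff : Lcvg [set B] A by move=> /(Uo _ _ dB)/(_ UA)[_ [-> ]].
exists F; split=> // x Fx; exists [set x]; split.
- by split; [exists x|move=> _ _ -> ->; exists x].
- by move=> _ ->; exists B => //; apply: AB; rewrite AF; exists x.
- move=> V /nbhs_singleton Vx; exists x => //= _ [-> _]; exact: Vx.
Qed.

Let open_setT : Lopen [set: LP P].
Proof. by move=> FF E [[A FA] _] _ _; exists A. Qed.

Let open_setI : setI_closed (@Lopen d P).
Proof.
move=> U V Uo Vo FF E dF FE [UE VE].
have [A [FA UA]] := Uo _ _ dF FE UE.
have [B [FB VB]] := Vo _ _ dF FE VE.
have [C [FC AC BC]] := dF.2 _ _ FA FB.
by exists C; split=> //; split; [exact: Lopen_up AC|exact: Lopen_up BC].
Qed.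

Let open_bigcup (I : Type) (f : I -> set (LP P)) :
  (forall i, Lopen (f i)) -> Lopen (\bigcup_i f i).
Proof.
move=> fo FF E dF FE [i _ fE].
by have [A [FA fA]] := fo i _ _ dF FE fE; exists A; split=> //; exists i.
Qed.

HB.instance Definition _ := isOpenTopological.Build (LP P)
  open_setT open_setI open_bigcup.

End LTopology.

Definition Gamma (X : topologicalType) : set (set X) :=
  [set A | closed A /\ A !=set0].
Arguments Gamma X : clear implicits.

(* [spec_le] is the specialization order; a point [x] lies below [y] when it is
   in the closure of [y], so that principal lower sets are closed. *)
Definition spec_le (X : topologicalType) (x y : X) : Prop :=
  closure [set y] x.

Definition tilde_closed (X : topologicalType) (S : set (Gamma X)) : Prop :=
  (forall (x : X) (A : Gamma X), val A = [set y | spec_le y x] -> S A) /\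
  (forall (DD : set (Gamma X)) (A : Gamma X),
     DD `<=` S -> directed DD -> isLub DD A -> S A).

Definition tilde (X : topologicalType) : set (Gamma X) :=
  [set A | forall S : set (Gamma X), tilde_closed S -> S A].
Arguments tilde X : clear implicits.

Definition FK (d : Order.disp_t) (P : porderType d) (K : set P) : set (LP P) :=
  [set E | exists F : set P,
     [/\ finite_set F, F !=set0, F `<=` K & val E = down F]].

(* Main.v *)
Require Import Defs.
From HB Require Import structures.
From mathcomp Require Import all_boot all_order.
From mathcomp Require Import boolp classical_sets functions cardinality filter topology.

(** For a closed [C] in [LP P] and a finite [B], the points [x] with
    [down (x |` B)] in [C] form a Scott closed set. Adjoining points one by one,
    a closed [C] containing [FK U] contains [FK (closure U)]. So a directed
    supremum of sets [FK K_i] is [FK] of the closure of the union of the [K_i],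
    and the [FK K] exhaust the closure of the principal lower sets
    [FK (val E)] under directed suprema. Conversely [FK K] is the directed
    supremum of the principal lower sets of its own elements. *)

Import Order.TTheory.
Local Open Scope classical_set_scope.
Local Open Scope order_scope.

Lemma LP_leP {d : Order.disp_t} {P : porderType d} (A B : LP P) :
  reflect (val A `<=` val B) (A <= B).
Proof. exact: subsetPset. Qed.

Lemma Gamma_leP {X : topologicalType} (A B : Gamma X) :
  reflect (val A `<=` val B) (A <= B).
Proof. exact: subsetPset. Qed.

Lemma directed_set1 {d : Order.disp_t} {T : porderType d} (x : T) :
  directed [set x].
Proof. by split; [exists x|move=> _ _ -> ->; exists x]. Qed.

Lemma sub_down {d : Order.disp_t} {T : porderType d} (F : set T) :
  F `<=` down F.
Proof. by move=> x Fx; exists x. Qed.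

Lemma down_subset {d : Order.disp_t} {T : porderType d} (F G : set T) :
  F `<=` G -> down F `<=` down G.
Proof. by move=> FG x [y [Fy xy]]; exists y; split=> //; exact: FG. Qed.

Lemma finite_adjoin {T : choiceType} (x : T) (B : set T) :
  finite_set B -> finite_set (x |` B).
Proof. by move=> finB; rewrite finite_setU; split=> //; exact: finite_set1. Qed.

Lemma set_seq_cons {T : eqType} (x : T) (s : seq T) :
  [set` x :: s] = x |` [set` s].
Proof.
apply/seteqP; split=> y /=; rewrite in_cons.
  by case/predU1P; [left|right].
by case=> [->|->]; rewrite ?eqxx ?orbT.
Qed.

(** * Scott closed sets and convergence of directed sets *)

Section ScottSpace.
Context {d : Order.disp_t} {P : porderType d}.

Lemma scott_closedP (K : set (scott P)) :
  closed K <->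
    (forall x y : P, K y -> x <= y -> K x) /\
    (forall (D : set P) (x : P), directed D -> D `<=` K -> isLub D x -> K x).
Proof.
rewrite -openC; split=> [[Kup Klub]|[Kdown Klub]].
  split=> [x y Ky xy|D x dD DK lx]; apply: contrapT => nKx.
    exact: Kup nKx xy Ky.
  by have [y [Dy nKy]] := Klub _ _ dD lx nKx; exact: nKy (DK _ Dy).
split=> [x y nKx xy Ky|D x dD lx nKx]; first exact: nKx (Kdown _ _ Ky xy).
apply: contrapT => DK; apply: nKx; apply: (Klub D) => // y Dy.
by apply: contrapT => nKy; apply: DK; exists y.
Qed.

Lemma isLub_scott_cvg (D : set P) (x : P) :
  directed D -> isLub D x -> scott_cvg D x.
Proof.
move=> dD lx V; rewrite nbhsE => -[U [Uo Ux] UV].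
have [a [Da Ua]] := Uo.2 _ _ dD lx Ux.
by exists a => // b [_ ab]; apply: UV; exact: Uo.1 Ua ab.
Qed.

Lemma scott_cvg1 (x : P) : scott_cvg [set x] x.
Proof.
apply: isLub_scott_cvg; first exact: directed_set1.
by split=> [_ ->//|b]; apply.
Qed.

Lemma closed_scott_cvg (K : set (scott P)) (D : set P) (x : P) :
  closed K -> D `<=` K -> scott_cvg D x -> K x.
Proof.
move=> Kc DK Dx; apply: contrapT => nKx.
have [a Da /(_ a (conj Da (lexx a)))] :=
  Dx _ (open_nbhs_nbhs (conj (closed_openC Kc) nKx)).
by apply; exact: DK.
Qed.

(** A finite union of principal lower sets, each closed since a least upper bound lies below every
    upper bound. *)
Lemma closed_down_finite (F : set P) :
  finite_set F -> closed (down F : set (scott P)).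
Proof.
move=> finF.
have -> : down F = \bigcup_(x in F) [set y | y <= x].
  by apply/seteqP; split=> y [x]; [case=> Fx yx; exists x|move=> Fx yx; exists x].
apply: (@closed_bigcup (scott P)) => // x _; apply/scott_closedP; split.
  by move=> y z /= zx yz; exact: le_trans zx.
by move=> D y _ Dx [_]; apply.
Qed.

End ScottSpace.

(** * Closed sets of [LP P] *)

Section LSpace.
Context {d : Order.disp_t} {P : porderType d}.

Definition down_LP (F : set P) (finF : finite_set F) (F0 : F !=set0) : LP P :=
  exist _ (down F) (mem_set (ex_intro _ F (And3 finF F0 erefl))).

Lemma LP_gen (E : LP P) :
  exists F : set P, [/\ finite_set F, F !=set0 & val E = down F].
Proof. exact: set_mem (valP E). Qed.

Lemma LP_nonempty (E : LP P) : val E !=set0.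
Proof. by have [F [_ [x Fx] ->]] := LP_gen E; exists x; exact: sub_down. Qed.

Lemma closed_LP (E : LP P) : closed (val E : set (scott P)).
Proof. by have [F [finF _ ->]] := LP_gen E; exact: closed_down_finite. Qed.

(** Frees membership from the choice of generators: a closed [K] is a lower set, so it contains the
    generators of [E] exactly when it contains all of [E]. *)
Lemma FKE (K : set (scott P)) :
  closed K -> @FK d P K = [set E : LP P | val E `<=` K].
Proof.
move=> /scott_closedP[Kdown _]; apply/seteqP; split=> E.
  by move=> [F [_ _ FsK EF]] /=; rewrite EF => x [y [/FsK Ky xy]]; exact: Kdown xy.
have [F [finF F0 EF]] := LP_gen E.
by move=> EK; exists F; split=> // x Fx; apply: EK; rewrite EF; exact: sub_down.
Qed.

Lemma L_closedP (C : set (LP P)) :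
  closed C <-> forall (FF : set (LP P)) (E : LP P),
    directed FF -> FF `<=` C -> Lcvg FF E -> C E.
Proof.
rewrite -openC -[open _]/(Lopen _); split=> Co FF E dF.
  move=> FC FE; apply: contrapT => nCE.
  by have [A [FA nCA]] := Co _ _ dF FE nCE; exact: nCA (FC _ FA).
move=> FE nCE; apply: contrapT => FC; apply: nCE; apply: (Co FF) => // A FA.
by apply: contrapT => nCA; apply: FC; exists A.
Qed.

(** The one-element family [[set B]] converges to every [A] below [B]: each generator of [A] is the
    limit of its own singleton. *)
Lemma L_closed_down (C : set (LP P)) (A B : LP P) :
  closed C -> C B -> val A `<=` val B -> C A.
Proof.
move=> /L_closedP Cc CB AB.
apply: (Cc [set B]); [exact: directed_set1|by move=> _ ->|].
have [F [finF F0 AF]] := LP_gen A; exists F; split=> // x Fx.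
exists [set x]; split; [exact: directed_set1| |exact: scott_cvg1].
by move=> _ ->; exists B => //; apply: AB; rewrite AF; exact: sub_down.
Qed.

(** A limit of a family from [FK K] is generated by Scott limits of directed sets inside [K], and a
    closed [K] keeps these limits and all points below them. *)
Lemma closed_FK (K : set (scott P)) : closed K -> closed (@FK d P K : set (LP P)).
Proof.
move=> Kc; rewrite FKE//; apply/L_closedP => FF E _ FFK [F [_ _ EF FD]] /=.
rewrite EF => y [x [/FD[D [_ DF Dx]] yx]].
apply: (((scott_closedP K).1 Kc).1 _ _ _ yx).
by apply: closed_scott_cvg Dx => // z /DF[A FA Az]; exact: (FFK A).
Qed.

Lemma FK_nonempty (K : set P) : K !=set0 -> @FK d P K !=set0.
Proof.
move=> [x Kx]; exists (down_LP [set x] (finite_set1 x) (ex_intro _ x erefl)).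
by exists [set x]; split=> //; [exists x|move=> _ ->].
Qed.

(** [FK (val E)] is closed and contains [E], hence contains the closure of [E]; conversely this
    closure, like every closed set, is a lower set. *)
Lemma spec_le_LP (E : LP P) : [set A | spec_le A E] = @FK d P (val E).
Proof.
rewrite (FKE (val E) (closed_LP E)); apply/seteqP; split=> A.
  rewrite /= /spec_le closureE => /(_ (@FK d P (val E))).
  rewrite (FKE (val E) (closed_LP E)); apply; split; last by move=> _ ->.
  by rewrite -(FKE (val E) (closed_LP E)); apply: closed_FK; exact: closed_LP.
move=> /= AE; apply: L_closed_down AE; first exact: closed_closure.
exact: subset_closure.
Qed.

(** If [x] is the least upper bound of a directed [D], the lower sets generated by [B] and one point
    of [D] form a directed family converging to the one generated by [B] and [x]. Quantifying over
    [E] keeps proofs of membership in [finlow P] out of the set. *)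
Lemma closed_adjoin (C : set (LP P)) (B : set P) : closed C -> finite_set B ->
  closed ([set x | forall E : LP P, val E = down (x |` B) -> C E]
           : set (scott P)).
Proof.
move=> Cc finB.
pose mk x := down_LP (x |` B) (finite_adjoin x B finB)
  (ex_intro _ x (or_introl erefl)).
have mk_mono (x y : P) : x <= y -> val (mk x) `<=` val (mk y).
  move=> xy z [t [[->|Bt] zt]].
    by exists y; split; [left|exact: le_trans xy].
  by exists t; split=> //; right.
apply/scott_closedP; split=> [x y Cy xy E Ex|D x dD DC lx E Ex].
  by apply: (L_closed_down C E (mk y)) => //; [exact: Cy|rewrite Ex; exact: mk_mono].
apply: ((L_closedP C).1 Cc (mk @` D)).
- have [[t Dt] Dd] := dD; split; first by exists (mk t); exists t.
  move=> _ _ [u Du <-] [v Dv <-]; have [w [Dw uw vw]] := Dd _ _ Du Dv.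
  by exists (mk w); split; [exists w|apply/LP_leP; exact: mk_mono..].
- by move=> _ [t Dt <-]; exact: (DC t Dt).
- exists (x |` B); split=> //; [exact: finite_adjoin|by exists x; left|].
  move=> y [->|By].
    exists D; split=> //; last exact: isLub_scott_cvg.
    by move=> t Dt; exists (mk t); [exists t|apply: sub_down; left].
  (* A generator from [B] lies in every [mk t]; since [D] is nonempty, there is such a [t]. *)
  exists [set y]; split; [exact: directed_set1| |exact: scott_cvg1].
  have [t Dt] := dD.1.
  by move=> _ ->; exists (mk t); [exists t|apply: sub_down; right].
Qed.

(* Points of the closure are adjoined one at a time to finite subsets of [U];
   each time [closed_adjoin] passes from [U] to its closure. *)
Lemma FK_closure_sub (C : set (LP P)) (U : set (scott P)) :
  closed C -> U !=set0 -> @FK d P U `<=` C -> @FK d P (closure U) `<=` C.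
Proof.
move=> Cc [u Uu] UC E [F [/finite_seqP[s ->] _ sU EF]].
(* [t] lists the points of the closure still to be treated; [G] gathers the points of [U] that have
   taken the place of the others. *)
have adjoin (t : seq P) : [set` t] `<=` closure U ->
    forall G : set P, finite_set G -> G !=set0 -> G `<=` U ->
    forall A : LP P, val A = down (G `|` [set` t]) -> C A.
  elim: t => [_ G finG G0 GU A AG|x t IH tU G finG G0 GU].
    by apply: UC; exists G; split=> //; rewrite AG set_nil setU0.
  have xU : closure U x by apply: tU; rewrite /= mem_head.
  have tU' : [set` t] `<=` closure U.
    by move=> y yt; apply: tU; rewrite /= in_cons yt orbT.
  have finB : finite_set (G `|` [set` t]).
    by rewrite finite_setU; split=> //; exact: finite_seq.
  move: xU; rewrite closureE => /(_ _ (conj (closed_adjoin C _ Cc finB) _)) xC A.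
  rewrite set_seq_cons setUCA; apply: xC => y Uy B; rewrite setUA; apply: IH => //.
  - exact: finite_adjoin.
  - by exists y; left.
  - by move=> z [->|/GU].
(* [u] makes the starting [G] nonempty. The lower set generated by [u] and [s] lies in [C] and
   contains [E]. *)
have finA : finite_set (u |` [set` s]) by apply: finite_adjoin; exact: finite_seq.
apply: (L_closed_down C E (down_LP _ finA (ex_intro _ u (or_introl erefl)))) => //.
  by apply: (adjoin s sU [set u]) => //; [exists u|move=> _ ->].
by rewrite EF; apply: down_subset => x; right.
Qed.

(** * The correspondence between closed sets of [P] and [tilde (LP P)] *)

Definition FK_Gamma (K : Gamma (scott P)) : Gamma (LP P) :=
  exist _ (@FK d P (val K)) (mem_set (conj (closed_FK _ (set_mem (valP K)).1)
    (FK_nonempty _ (set_mem (valP K)).2))).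

(** By [spec_le_LP], [FK_Gamma (LP_Gamma E)] is the principal lower set of [E]. *)
Definition LP_Gamma (E : LP P) : Gamma (scott P) :=
  exist _ (val E) (mem_set (conj (closed_LP E) (LP_nonempty E))).

(** [K] is recovered from [FK K] by testing the lower sets of single points. *)
Lemma FK_subset (K L : set (scott P)) :
  closed L -> @FK d P K `<=` (@FK d P L : set (LP P)) <-> K `<=` L.
Proof.
move=> Lc; split=> [KL x Kx|KL E [F [finF F0 FsK EF]]]; last first.
  by exists F; split=> //; exact: subset_trans KL.
pose E := down_LP [set x] (finite_set1 x) (ex_intro _ x erefl).
have : @FK d P K E by exists [set x]; split=> //; [exists x|move=> _ ->].
by move/KL; rewrite FKE//; apply; exact: sub_down.
Qed.

Lemma tilde_FK (K : Gamma (scott P)) : tilde (LP P) (FK_Gamma K).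
Proof.
have [Kc K0] := set_mem (valP K).
move=> S [Sprinc Slub].
pose DD := [set FK_Gamma (LP_Gamma E) | E in @FK d P (val K)].
apply: (Slub DD).
- by move=> _ [E _ <-]; apply: (Sprinc E); rewrite spec_le_LP.
- split; first by have [E KE] := FK_nonempty _ K0; exists (FK_Gamma (LP_Gamma E)), E.
  move=> _ _ [A [F [finF F0 FsK AF]] <-] [B [G [finG G0 GsK BG]] <-].
  have finFG : finite_set (F `|` G) by rewrite finite_setU.
  have FG0 : F `|` G !=set0 by have [x Fx] := F0; exists x; left.
  (* Joining the two generating sets gives a common upper bound. *)
  exists (FK_Gamma (LP_Gamma (down_LP _ finFG FG0))); split.
  + exists (down_LP _ finFG FG0) => //.
    by exists (F `|` G)%classic; split=> // x [/FsK|/GsK].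
  + apply/Gamma_leP; apply/FK_subset; first exact: closed_down_finite.
    by rewrite /= AF; apply: down_subset => x; left.
  + apply/Gamma_leP; apply/FK_subset; first exact: closed_down_finite.
    by rewrite /= BG; apply: down_subset => x; right.
- split=> [_ [E KE <-]|B Bub]; apply/Gamma_leP.
    by apply/FK_subset => //; move: KE; rewrite FKE.
  (* An upper bound contains [FK (val E)], and so the point [E] in it. *)
  move=> E KE; have /Gamma_leP := Bub _ (ex_intro2 _ _ E KE erefl); apply.
  by rewrite /= FKE//; exact: closed_LP.
Qed.

Lemma tilde_FKP (A : Gamma (LP P)) :
  tilde (LP P) A -> exists K, A = FK_Gamma K.
Proof.
move=> /(_ [set A | exists K, A = FK_Gamma K]); apply; split.
  by move=> E B BE; exists (LP_Gamma E); apply/val_inj; rewrite BE spec_le_LP.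
move=> DD {}A DDK [[A0 DA0] dDD] [Aub Alub].
pose KK := [set K | DD (FK_Gamma K)].
pose U : set (scott P) := \bigcup_(K in KK) val K.
have U0 : U !=set0.
  have [K AK] := DDK _ DA0; have [_ [x Kx]] := set_mem (valP K).
  by exists x, K => //; rewrite /KK /= -AK.
have clU0 : closure U !=set0 by have [x Ux] := U0; exists x; exact: subset_closure.
pose L : Gamma (scott P) :=
  exist _ (closure U) (mem_set (conj (@closed_closure _ U) clU0)).
exists L; apply/le_anti/andP; split.
  apply: Alub => B DB; have [K BK] := DDK _ DB; apply/Gamma_leP.
  rewrite BK; apply/FK_subset; first exact: closed_closure.
  apply: subset_trans (@subset_closure _ U).
  by move=> x Kx; exists K => //; rewrite /KK /= -BK.
(* [A] is closed, so it is enough that it contains [FK U]. *)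
apply/Gamma_leP; apply: FK_closure_sub => //; first exact: (set_mem (valP A)).1.
move=> E [F [/finite_seqP[s ->] s0 sU Es]].
(* Finitely many points of a directed union lie in one member; [FK_subset] carries the directedness
   of [DD] over to [KK]. *)
have [K DK sK] : exists2 K, KK K & [set` s] `<=` val K.
  elim: s sU {s0 Es} => [_|x s IH sU].
    by have [K AK] := DDK _ DA0; exists K => //; rewrite /KK /= -AK.
  have [|K DK sK] := IH; first by move=> y ys; apply: sU; rewrite /= in_cons ys orbT.
  have [|M DM Mx] := sU x; first by rewrite /= mem_head.
  have [B [DB KB MB]] := dDD _ _ DK DM; have [N BN] := DDK _ DB.
  have Nc := (set_mem (valP N)).1.
  move: KB MB; rewrite BN => /Gamma_leP/(FK_subset _ _ Nc) KN.
  move=> /Gamma_leP/(FK_subset _ _ Nc) MN.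
  exists N; first by rewrite /KK /= -BN.
  by rewrite set_seq_cons => y [->|/sK/KN//]; exact: MN.
by have /Gamma_leP := Aub _ DK; apply; exists [set` s].
Qed.

End LSpace.

Theorem theorem5p13 (d : Order.disp_t) (P : porderType d) (hP : dcpo P) :
  exists f : Gamma (scott P) -> tilde (LP P),
    order_iso f /\ forall K : Gamma (scott P), val (val (f K)) = @FK d P (val K).
Proof.
pose f (K : Gamma (scott P)) : tilde (LP P) :=
  exist _ (FK_Gamma K) (mem_set (tilde_FK K)).
exists f; split=> //.
have f_mono : {mono f : K L / K <= L}.
  move=> K L; have Lc := (set_mem (valP L)).1.
  apply/idP/idP => /Gamma_leP KL; apply/Gamma_leP; exact/(FK_subset _ _ Lc).
split=> //.
have f_surj (A : tilde (LP P)) : exists K, f K = A.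
  by have [K AK] := tilde_FKP _ (set_mem (valP A)); exists K; exact/val_inj.
(* The right inverse [g] is also a left inverse, because the order embedding [f] is injective. *)
have [g fg] := choice f_surj.
by exists g => // K; apply: (inc_inj f_mono); rewrite fg.
Qed.
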